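(* Suppose that the level set $\mathcal{L}_f(x_0)$ is compact and that $f$ is twice Lipschitz continuously differentiable in the sense described in the context. Then Algorithm A, run with tolerances $\epsilon_g,\epsilon_H\in(0,1)$, reaches an iterate $x_k$ that satisfies $$\min\{\|g_k\|,\|g_{k+1}\|\}\le \epsilon_g\quad\text{and}\quad \lambda_{\min}(\nabla^2 f(x_k))\ge -\epsilon_H$$ in at most $$\mathcal{C}\,\max\left\{\epsilon_g^{-3}\epsilon_H^{3},\ \epsilon_g^{-3/2},\ \epsilon_H^{-3}\right\}\ \text{ iterations}$$ (that is, the smallest index $k$ for which this holds is bounded by this quantity), where $$\mathcal{C}:=\frac{f(x_0)-f_{\mathrm{low}}}{c},\qquad c:=\min\{c_e,c_g,c_n,c_r\},$$ with $$c_e=\frac{\eta}{6}\min\left\{1,\frac{27\theta^3}{(L_H+\eta)^3}\right\},\qquad c_g=\frac{\eta}{6}\min\left\{1,\frac{\theta^3}{(L_H+\eta)^{3/2}},\frac{125\theta^3}{27}\right\},$$ $$c_n=\frac{\eta}{6}\min\left\{\left[\frac{2}{L_H}\right]^{3/2},\left[\frac{3\theta}{L_H+\eta}\right]^3\right\},\qquad c_r=\frac{\eta}{6}\min\left\{\left[\frac{1}{1+\sqrt{1+L_H/2}}\right]^3,\left[\frac{6\theta}{L_H+\eta}\right]^3\right\}.$$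
   Context: $\|\cdot\|$ is the Euclidean norm (and induced matrix norm), $[t]_+=\max\{t,0\}$, $g_k=\nabla f(x_k)$. Setting. $f:\mathbb{R}^n\to\mathbb{R}$, $x_0\in\mathbb{R}^n$, $\mathcal{L}_f(x_0)=\{x : f(x)\le f(x_0)\}$ is assumed compact. $f$ is twice Lipschitz continuously differentiable on an open set $\mathcal{N}$ containing $\mathcal{L}_f(x_0)$ and all segments $[x_k,x_k+d_k]$ ($x_k$ the iterates and $d_k$ the search directions below), with $L_g,L_H>0$ Lipschitz constants of $\nabla f$ and $\nabla^2 f$ on $\mathcal{N}$. The constants $f_{\mathrm{low}}\in\mathbb{R}$, $U_g>0$, $U_H>0$ satisfy $f(x)\ge f_{\mathrm{low}}$, $\|\nabla f(x)\|\le U_g$, $\|\nabla^2 f(x)\|\le U_H$ for all $x\in\mathcal{L}_f(x_0)$. Algorithm A. Parameters: $x_0$, $\theta\in(0,1)$, $\eta>0$, $\epsilon_g,\epsilon_H\in(0,1)$. For $k=0,1,2,\dots$: Step 1. Set $g_k=\nabla f(x_k)$. If $\|g_k\|=0$ go to Step 2. Otherwise compute $R_k=g_k^\top\nabla^2 f(x_k)g_k/\|g_k\|^2$. If $R_k<-\epsilon_H$, set $d_k=\frac{R_k}{\|g_k\|}g_k$ and go to Step LS. Else if $R_k\in[-\epsilon_H,\epsilon_H]$ and $\|g_k\|>\epsilon_g$, set $d_k=-g_k/\|g_k\|^{1/2}$ and go to Step LS. Else go to Step 2. Step 2. Compute $\lambda_k=\lambda_{\min}(\nabla^2 f(x_k))$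 and $v_k$ with $\nabla^2 f(x_k)v_k=\lambda_kv_k$, $v_k^\top g_k\le0$, $\|v_k\|=[-\lambda_k]_+$. If $\|g_k\|\le\epsilon_g$ and $\lambda_k\ge-\epsilon_H$, terminate. Else if $\lambda_k<-\epsilon_H$, set $d_k=v_k$. Else if $\lambda_k>\epsilon_H$, set $d_k=d_k^n$ with $\nabla^2 f(x_k)d_k^n=-g_k$ (Newton direction). Else set $d_k=d_k^r$ with $(\nabla^2 f(x_k)+2\epsilon_HI)d_k^r=-g_k$ (regularized Newton direction). Step LS. Let $\alpha_k=\theta^{j_k}$, where $j_k$ is the smallest nonnegative integer such that $f(x_k+\alpha_kd_k)<f(x_k)-\frac{\eta}{6}\alpha_k^3\|d_k\|^3$; set $x_{k+1}=x_k+\alpha_kd_k$. If $d_k\in\{d_k^n,d_k^r\}$ and $\|\nabla f(x_{k+1})\|\le\epsilon_g$, terminate. If the algorithm terminates in Step 2 at iteration $k$ (so $x_{k+1}$ is not computed), the condition $\min\{\|g_k\|,\|g_{k+1}\|\}\le\epsilon_g$ is regarded as satisfied since $\|g_k\|\le\epsilon_g$. *)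

(* Defs.v *)
From HB Require Import structures.
From mathcomp Require Import all_boot all_order all_algebra.
From mathcomp Require Import all_classical all_reals all_analysis.

Set Implicit Arguments.
Unset Strict Implicit.
Unset Printing Implicit Defensive.

Import Order.TTheory GRing.Theory Num.Theory.
Import numFieldNormedType.Exports.

Local Open Scope classical_set_scope.
Local Open Scope ring_scope.

(* Vectors are rows, as in the Jacobian of MathComp-Analysis and the
   eigenvalues of MathComp: the product "A v" of the text is v *m A. *)

(* The norm `|_| of the library on 'rV[R]_n is the sup norm, so the Euclidean
   norm and the operator norm it induces are defined here. *)
Definition dotv (R : realType) (n : nat) (u v : 'rV[R]_n) : R :=
  (u *m v^T) 0 0.

Definition enorm (R : realType) (n : nat) (v : 'rV[R]_n) : R :=
  Num.sqrt (dotv v v).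

Definition opnorm (R : realType) (n : nat) (A : 'M[R]_n) : R :=
  sup [set enorm (v *m A) | v in [set v : 'rV[R]_n | enorm v <= 1]].

(* The spectrum is finite, and nonempty when A is symmetric and n > 0, so that
   this infimum is then a minimum. *)
Definition lambda_min (R : realType) (n : nat) (A : 'M[R]_n) : R :=
  inf [set a | eigenvalue A a].

Definition gradient (R : realType) (n : nat) (f : 'rV[R]_n -> R)
    (x : 'rV[R]_n) : 'rV[R]_n :=
  \row_i 'D_(delta_mx 0 i) f x.

Definition hessian (R : realType) (n : nat) (f : 'rV[R]_n -> R)
    (x : 'rV[R]_n) : 'M[R]_n :=
  'J (gradient f) x.

Definition level_set (R : realType) (n : nat) (f : 'rV[R]_n -> R)
    (x0 : 'rV[R]_n) : set 'rV[R]_n :=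
  [set x | f x <= f x0].

Definition segment (R : realType) (n : nat) (x y : 'rV[R]_n) : set 'rV[R]_n :=
  [set x + t *: (y - x) | t in `[0, 1]].

Definition twice_lipschitz_diff (R : realType) (n : nat) (f : 'rV[R]_n -> R)
    (N : set 'rV[R]_n) (L_g L_H : R) : Prop :=
  [/\ forall x, N x -> differentiable f x,
      forall x, N x -> differentiable (gradient f) x,
      forall x y, N x -> N y ->
        enorm (gradient f x - gradient f y) <= L_g * enorm (x - y) &
      forall x y, N x -> N y ->
        opnorm (hessian f x - hessian f y) <= L_H * enorm (x - y)].

(* What Steps 1 and 2 produce: termination, or a search direction together
   with a flag telling whether it is one of d^n, d^r. *)
Inductive outcome (R : realType) (n : nat) : Type :=
| Terminate
| Direction of bool & 'rV[R]_n.

Arguments Terminate {R n}.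
Arguments Direction {R n} _ _.

(* [None] means "go to Step 2". *)
Definition step1 (R : realType) (n : nat) (f : 'rV[R]_n -> R)
    (eps_g eps_H : R) (x : 'rV[R]_n) : option 'rV[R]_n :=
  let g := gradient f x in
  let r := dotv (g *m hessian f x) g / enorm g ^+ 2 in
  if enorm g == 0 then None
  else if r < - eps_H then Some ((r / enorm g) *: g)
  else if (- eps_H <= r <= eps_H) && (eps_g < enorm g) then
    Some (- ((Num.sqrt (enorm g))^-1 *: g))
  else None.

Definition step2 (R : realType) (n : nat) (f : 'rV[R]_n -> R)
    (eps_g eps_H : R) (x : 'rV[R]_n) (o : outcome R n) : Prop :=
  let g := gradient f x in
  let H := hessian f x in
  let lambda := lambda_min H in
  exists v : 'rV[R]_n,
    [/\ v *m H = lambda *: v, dotv v g <= 0,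
        enorm v = Num.max (- lambda) 0 &
        if (enorm g <= eps_g) && (- eps_H <= lambda) then o = Terminate
        else if lambda < - eps_H then o = Direction false v
        else if eps_H < lambda then
          exists2 d, d *m H = - g & o = Direction true d
        else
          exists2 d, d *m (H + (2 * eps_H)%:M) = - g & o = Direction true d].

Definition steps12 (R : realType) (n : nat) (f : 'rV[R]_n -> R)
    (eps_g eps_H : R) (x : 'rV[R]_n) (o : outcome R n) : Prop :=
  if step1 f eps_g eps_H x is Some d then o = Direction false d
  else step2 f eps_g eps_H x o.

Definition sufficient_decrease (R : realType) (n : nat) (f : 'rV[R]_n -> R)
    (eta : R) (x d : 'rV[R]_n) (alpha : R) : bool :=
  f (x + alpha *: d) < f x - eta / 6 * alpha ^+ 3 * enorm d ^+ 3.

Definition step_ls (R : realType) (n : nat) (f : 'rV[R]_n -> R)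
    (theta eta : R) (x d y : 'rV[R]_n) : Prop :=
  exists j : nat,
    [/\ sufficient_decrease f eta x d (theta ^+ j),
        forall i, (i < j)%N -> ~~ sufficient_decrease f eta x d (theta ^+ i) &
        y = x + theta ^+ j *: d].

(* Does the run stop on computing y at the end of an iteration with
   outcome o? *)
Definition stops_after_ls (R : realType) (n : nat) (f : 'rV[R]_n -> R)
    (eps_g : R) (o : option (outcome R n)) (y : 'rV[R]_n) : bool :=
  if o is Some (Direction true _) then enorm (gradient f y) <= eps_g else false.

(* The point at which iteration k starts, if there is an iteration k. *)
Definition iteration_start (R : realType) (n : nat) (f : 'rV[R]_n -> R)
    (eps_g : R) (x : nat -> option 'rV[R]_n) (o : nat -> option (outcome R n))
    (k : nat) : option 'rV[R]_n :=
  if k is k'.+1 then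
    if x k'.+1 is Some y then
      if stops_after_ls f eps_g (o k') y then None else Some y
    else None
  else x 0.

(* A complete, finite or infinite, run: x k is the k-th iterate and o k the
   outcome of Steps 1-2 at iteration k, each being None when it is not
   computed.  Steps 1-2 fail to produce an outcome only if no admissible one
   exists, and the line search fails to produce the next iterate only if no
   step length theta ^+ j is acceptable: neither failure is excluded here. *)
Record algorithm_run (R : realType) (n : nat) (f : 'rV[R]_n -> R)
    (x0 : 'rV[R]_n) (theta eta eps_g eps_H : R)
    (x : nat -> option 'rV[R]_n) (o : nat -> option (outcome R n)) : Prop := {
  run_start : x 0 = Some x0 ;
  run_steps12 : forall k,
    match iteration_start f eps_g x o k, o k with
    | Some xk, Some ok => steps12 f eps_g eps_H xk ok
    | Some xk, None => forall ok, ~ steps12 f eps_g eps_H xk ok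
    | None, ok => ok = None
    end ;
  run_ls : forall k,
    match x k, o k with
    | Some xk, Some (Direction _ d) =>
        if x k.+1 is Some y then step_ls f theta eta xk d y
        else forall y, ~ step_ls f theta eta xk d y
    | _, _ => x k.+1 = None
    end }.

(* min {|g_k|, |g_(k+1)|}, read as |g_k| when x_(k+1) is not computed. *)
Definition min_gradient_norm (R : realType) (n : nat) (f : 'rV[R]_n -> R)
    (xk : 'rV[R]_n) (xk1 : option 'rV[R]_n) : R :=
  if xk1 is Some y then
    Num.min (enorm (gradient f xk)) (enorm (gradient f y))
  else enorm (gradient f xk).

Definition c_e (R : realType) (theta eta L_H : R) : R :=
  eta / 6 * Num.min 1 (27 * theta ^+ 3 / (L_H + eta) ^+ 3).

Definition c_g (R : realType) (theta eta L_H : R) : R :=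
  eta / 6 * Num.min 1 (Num.min (theta ^+ 3 / (L_H + eta) `^ (3 / 2))
                               (125 * theta ^+ 3 / 27)).

Definition c_n (R : realType) (theta eta L_H : R) : R :=
  eta / 6 * Num.min ((2 / L_H) `^ (3 / 2)) ((3 * theta / (L_H + eta)) ^+ 3).

Definition c_r (R : realType) (theta eta L_H : R) : R :=
  eta / 6 * Num.min ((1 / (1 + Num.sqrt (1 + L_H / 2))) ^+ 3)
                    ((6 * theta / (L_H + eta)) ^+ 3).

Definition c_min (R : realType) (theta eta L_H : R) : R :=
  Num.min (Num.min (c_e theta eta L_H) (c_g theta eta L_H))
          (Num.min (c_n theta eta L_H) (c_r theta eta L_H)).

(* Main.v *)
Require Import Defs.
From mathcomp Require Import all_boot all_order all_algebra.
From mathcomp Require Import all_classical all_reals all_analysis.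
From mathcomp Require Import ring lra.
Import Order.TTheory GRing.Theory Num.Theory.
Import numFieldNormedType.Exports.
Local Open Scope classical_set_scope.
Local Open Scope ring_scope.

(** Every iteration that does not meet the target decreases f by a fixed amount,
    and f cannot fall below f_low.

    The line search gives f (x_(k+1)) < f (x_k) - eta / 6 |x_(k+1) - x_k|^3, so
    it suffices to bound the length of a step from below.  All the constants are
    made of cubes: c_min = eta / 6 * step_factor^3 ([c_minE]), and the part of
    the bound that depends on the tolerances is at least length_scale^-3
    ([length_scale_max]), where length_scale is the least of eps_g / eps_H,
    sqrt eps_g and eps_H.  The heart of the proof is that every step is at least
    step_factor * length_scale long, unless a full Newton or regularized Newton
    step lands on a gradient of norm at most eps_g, in which case the target is
    met ([iteration_progress]).

    The length of a step is bounded in two ways.  If backtracking occurred, some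
    trial step a d was rejected, and comparing the rejection with the Taylor
    expansion of f along d, whose remainder is at most L_H / 6 a^3 |d|^3, bounds
    a |d| from below (lemmas [..._rejected]); the accepted step is shorter by a
    factor theta only.  If the full step was accepted, d itself is long: along
    negative curvature |d| exceeds eps_H, for the scaled gradient |d| is
    sqrt |g|, and a Newton step towards a gradient that is still larger than
    eps_g cannot be short, because that gradient is the remainder of a Taylor
    expansion, up to the effect of the regularization (lemmas [..._full_step]).

    A run could also end for want of a direction or of an acceptable step length.
    The second is excluded by the same lower bound on rejected steps.  The first
    needs spectral theory: the Hessian is symmetric ([hessian_sym]), so that its
    smallest eigenvalue is attained and is the minimum of the Rayleigh quotient
    ([lambda_min_spec]), and the systems that define the Newton directions are
    positive definite. *)

(** * Euclidean geometry of row vectors *)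

Section EuclideanSpace.
Context {R : realType} {n : nat}.
Implicit Types (u v w : 'rV[R]_n) (A : 'M[R]_n) (a : R).

Lemma dotvE u v : dotv u v = \sum_i u 0 i * v 0 i.
Proof. by rewrite /dotv mxE; apply: eq_bigr => i _; rewrite mxE. Qed.

Lemma dotvC u v : dotv u v = dotv v u.
Proof. by rewrite !dotvE; apply: eq_bigr => i _; rewrite mulrC. Qed.

Lemma dotvDl u v w : dotv (u + v) w = dotv u w + dotv v w.
Proof. by rewrite /dotv mulmxDl mxE. Qed.

Lemma dotvZl a u v : dotv (a *: u) v = a * dotv u v.
Proof. by rewrite /dotv -scalemxAl mxE. Qed.

Lemma dotvNl u v : dotv (- u) v = - dotv u v.
Proof. by rewrite -scaleN1r dotvZl mulN1r. Qed.

Lemma dotvBl u v w : dotv (u - v) w = dotv u w - dotv v w.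
Proof. by rewrite dotvDl dotvNl. Qed.

Lemma dotvDr u v w : dotv w (u + v) = dotv w u + dotv w v.
Proof. by rewrite dotvC dotvDl !(dotvC w). Qed.

Lemma dotvZr a u v : dotv v (a *: u) = a * dotv v u.
Proof. by rewrite dotvC dotvZl (dotvC v). Qed.

Lemma dotvNr u v : dotv v (- u) = - dotv v u.
Proof. by rewrite dotvC dotvNl (dotvC v). Qed.

Lemma dotvBr u v w : dotv w (u - v) = dotv w u - dotv w v.
Proof. by rewrite dotvDr dotvNr. Qed.

Lemma dotv0l v : dotv 0 v = 0.
Proof. by rewrite /dotv mul0mx mxE. Qed.

Lemma dotvv_ge0 v : 0 <= dotv v v.
Proof. by rewrite dotvE sumr_ge0 // => i _; rewrite -expr2 sqr_ge0. Qed.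

Lemma dotvv_eq0 v : (dotv v v == 0) = (v == 0).
Proof.
apply/idP/eqP => [|->]; last by rewrite dotv0l eqxx.
rewrite dotvE psumr_eq0 => [/allP h|i _]; last by rewrite -expr2 sqr_ge0.
apply/rowP => i; rewrite mxE; apply/eqP.
by have := h i (mem_index_enum i); rewrite /= -expr2 sqrf_eq0.
Qed.

Lemma enorm_ge0 v : 0 <= enorm v.
Proof. exact: sqrtr_ge0. Qed.

Lemma sqr_enorm v : enorm v ^+ 2 = dotv v v.
Proof. by rewrite /enorm sqr_sqrtr // dotvv_ge0. Qed.

Lemma enorm_eq0 v : (enorm v == 0) = (v == 0).
Proof. by rewrite -sqrf_eq0 sqr_enorm dotvv_eq0. Qed.

Lemma enorm0 : enorm (0 : 'rV[R]_n) = 0.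
Proof. by apply/eqP; rewrite enorm_eq0. Qed.

Lemma enormZ a v : enorm (a *: v) = `|a| * enorm v.
Proof.
by rewrite /enorm dotvZl dotvZr mulrA -expr2 sqrtrM ?sqr_ge0// sqrtr_sqr.
Qed.

Lemma enormN v : enorm (- v) = enorm v.
Proof. by rewrite -scaleN1r enormZ normrN1 mul1r. Qed.

Lemma sqr_dotv_le u v : dotv u v ^+ 2 <= dotv u u * dotv v v.
Proof.
have [/eqP|v0] := boolP (dotv v v == 0).
  by move/eqP; rewrite dotvv_eq0 => /eqP->; rewrite dotvC !dotv0l expr0n mulr0.
have vgt0 : 0 < dotv v v by rewrite lt0r v0 dotvv_ge0.
have := dotvv_ge0 (dotv v v *: u - dotv u v *: v).
rewrite !(dotvBl, dotvBr, dotvZl, dotvZr) (dotvC v u).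
set a := dotv u u; set b := dotv u v; set c := dotv v v in v0 vgt0 *.
rewrite (_ : _ - _ = c * (a * c - b ^+ 2)); last by ring.
by rewrite pmulr_rge0 // subr_ge0.
Qed.

Lemma normr_dotv_le u v : `|dotv u v| <= enorm u * enorm v.
Proof.
rewrite -(@ler_pXn2r _ 2) ?nnegrE ?mulr_ge0 ?enorm_ge0 //.
by rewrite exprMn !sqr_enorm real_normK ?num_real // sqr_dotv_le.
Qed.

Lemma enormD_le u v : enorm (u + v) <= enorm u + enorm v.
Proof.
rewrite -(@ler_pXn2r _ 2) ?nnegrE ?addr_ge0 ?enorm_ge0 //.
rewrite sqrrD !sqr_enorm !(dotvDl, dotvDr) (dotvC v u).
have := le_trans (ler_norm _) (normr_dotv_le u v); lra.
Qed.

(** The set whose supremum is the operator norm is bounded, by the Frobenius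
    norm, so that the supremum is an actual bound. *)
Lemma enorm_mulmx_le A v : enorm (v *m A) <= opnorm A * enorm v.
Proof.
pose F := \sum_j dotv (col j A)^T (col j A)^T.
have Fge0 : 0 <= F by apply: sumr_ge0 => j _; exact: dotvv_ge0.
have mulE u j : (u *m A) 0 j = dotv u (col j A)^T.
  by rewrite dotvE mxE; apply: eq_bigr => i _; rewrite !mxE.
have frob u : enorm (u *m A) <= Num.sqrt F * enorm u.
  rewrite -(@ler_pXn2r _ 2) ?nnegrE ?mulr_ge0 ?enorm_ge0 ?sqrtr_ge0 //.
  rewrite exprMn !sqr_enorm sqr_sqrtr // dotvE /F mulr_suml.
  apply: ler_sum => j _; rewrite -expr2 mulE mulrC; exact: sqr_dotv_le.
have opub : has_sup [set enorm (v *m A) | v in [set v : 'rV[R]_n | enorm v <= 1]].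
  split; first by exists (enorm ((0 : 'rV[R]_n) *m A)), 0 => //=; rewrite enorm0.
  exists (Num.sqrt F) => _ [u /= u1 <-]; apply: le_trans (frob u) _.
  by rewrite ler_piMr // sqrtr_ge0.
have [->|v0] := eqVneq v 0; first by rewrite mul0mx !enorm0 mulr0.
have vgt0 : 0 < enorm v by rewrite lt0r enorm_eq0 v0 enorm_ge0.
rewrite -ler_pdivrMr // mulrC.
have -> : (enorm v)^-1 * enorm (v *m A) = enorm (((enorm v)^-1 *: v) *m A).
  by rewrite -scalemxAl enormZ gtr0_norm ?invr_gt0.
apply: ub_le_sup; first by case: opub.
exists ((enorm v)^-1 *: v) => //=.
by rewrite enormZ gtr0_norm ?invr_gt0 // mulVf // gt_eqF.
Qed.

Lemma normr_dotv_mulmx_le A u v :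
  `|dotv (u *m A) v| <= opnorm A * enorm u * enorm v.
Proof.
apply: le_trans (normr_dotv_le _ _) _.
by rewrite ler_wpM2r ?enorm_ge0 // enorm_mulmx_le.
Qed.

End EuclideanSpace.

(** * Taylor estimates along a line *)

Section RealLine.
Context {R : realType}.
Implicit Types (h dh p dp q dq : R -> R) (a c : R).

Lemma derive_le0_le h dh a : 0 <= a ->
  (forall t, 0 <= t <= a -> is_derive t 1 h (dh t)) ->
  (forall t, 0 <= t <= a -> dh t <= 0) -> h a <= h 0.
Proof.
move=> a0 hd dh0; have [t|t|c] := @MVT_segment R h dh 0 a a0.
- by rewrite in_itv /= => /andP[t0 ta]; apply: hd; rewrite !ltW.
- by apply: derivable_within_continuous => s; rewrite in_itv /= => /hd [].
rewrite in_itv /= => /dh0 hc E.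
by rewrite -subr_le0 E subr0 mulr_le0_ge0.
Qed.

(** Derivative bounds are integrated by comparison: both q - p and q + p are
    nondecreasing. *)
Lemma normr_increment_le p dp q dq a : 0 <= a ->
  (forall t, 0 <= t <= a -> is_derive t 1 p (dp t)) ->
  (forall t, 0 <= t <= a -> is_derive t 1 q (dq t)) ->
  (forall t, 0 <= t <= a -> `|dp t| <= dq t) -> `|p a - p 0| <= q a - q 0.
Proof.
move=> a0 pd qd le_dpq.
have h1 : (p - q) a <= (p - q) 0.
  apply: (@derive_le0_le _ (fun t => dp t - dq t)) => // t ta.
    exact: is_deriveB (pd t ta) (qd t ta).
  by rewrite subr_le0 (le_trans (ler_norm _)) // le_dpq.
have h2 : (- p - q) a <= (- p - q) 0.
  apply: (@derive_le0_le _ (fun t => - dp t - dq t)) => // t ta.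
    exact: is_deriveB (is_deriveN (pd t ta)) (qd t ta).
  by rewrite subr_le0 (le_trans (ler_norm _)) // normrN le_dpq.
by rewrite ler_norml; move: h1 h2; rewrite !fctE; lra.
Qed.

Lemma is_derive_monomial c k (t : R) :
  is_derive t 1 (fun s => c / k.+1%:R * s ^+ k.+1) (c * t ^+ k).
Proof.
have := is_deriveZ (c / k.+1%:R) (is_deriveX k.+1 (is_derive_id t 1)).
rewrite [X in is_derive _ _ X](_ : _ = fun s => c / k.+1%:R * s ^+ k.+1).
  move/is_derive_eq; apply; rewrite /= /GRing.scale /= mulr1.
  by rewrite mulrA divfK // pnatr_eq0.
by apply/funext => s; rewrite !fctE.
Qed.

End RealLine.

Section Lines.
Context {R : realType} {n : nat}.
Implicit Types (x d u : 'rV[R]_n) (t : R).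

(** The difference quotients of the restriction to the line are those of the
    directional derivative. *)
Lemma is_derive_line (W : normedModType R) (F : 'rV[R]_n -> W) x d t :
  differentiable F (x + t *: d) ->
  is_derive t 1 (fun s : R => F (x + s *: d)) ('D_d F (x + t *: d)).
Proof.
move=> Fd; have Fdd : derivable F (x + t *: d) d by exact: diff_derivable.
have E : (fun h : R =>
             h^-1 *: (((fun s : R => F (x + s *: d)) \o shift t) (h *: 1)
             - F (x + t *: d))) =
         (fun h : R => h^-1 *: ((F \o shift (x + t *: d)) (h *: d)
             - F (x + t *: d))).
  apply/funext => h /=; rewrite [h *: 1]mulr1 scalerDl.
  by rewrite addrCA.
by apply: DeriveDef; rewrite /derivable /derive E.
Qed.

Lemma derive_dotv_gradient (f : 'rV[R]_n -> R) x d :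
  differentiable f x -> 'D_d f x = dotv (gradient f x) d.
Proof.
move=> fd; rewrite deriveE // [in LHS](row_sum_delta d) linear_sum dotvE.
apply: eq_bigr => i _; rewrite linearZ /= mxE deriveE //.
by rewrite mulrC.
Qed.

Lemma is_derive_dotv (G : R -> 'rV[R]_n) t dG u :
  is_derive t 1 G dG -> is_derive t 1 (fun s => dotv (G s) u) (dotv dG u).
Proof.
move=> [Gd <-]; have Gdi := (derivable_mxP G t 1).1 Gd 0.
have := is_derive_sum
  (fun i => is_deriveZ (u 0 i) (@derivableP _ _ _ _ _ _ (Gdi i))).
rewrite [X in is_derive _ _ X](_ : _ = fun s => dotv (G s) u); last first.
  apply/funext => s; rewrite dotvE fct_sumE; apply: eq_bigr => i _.
  by rewrite /= mulrC.
move/is_derive_eq; apply; rewrite dotvE; apply: eq_bigr => i _.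
by rewrite derive_mx // mxE mulrC.
Qed.

End Lines.

Section Taylor.
Context {R : realType} {n : nat} {f : 'rV[R]_n -> R} {N : set 'rV[R]_n}.
Context {L_g L_H : R} (fN : twice_lipschitz_diff f N L_g L_H).
Implicit Types (x d u v : 'rV[R]_n) (a s t : R).

Local Notation grad := (gradient f).
Local Notation hess := (hessian f).

Lemma is_derive_f_line x d t : N (x + t *: d) ->
  is_derive t 1 (fun s : R => f (x + s *: d)) (dotv (grad (x + t *: d)) d).
Proof.
case: fN => fd _ _ _ Nx; rewrite -derive_dotv_gradient; last exact: fd.
exact/is_derive_line/fd.
Qed.

Lemma is_derive_gradient_line x d u t : N (x + t *: d) ->
  is_derive t 1 (fun s : R => dotv (grad (x + s *: d)) u)
            (dotv (d *m hess (x + t *: d)) u).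
Proof.
case: fN => _ gd _ _ Nx; apply: is_derive_dotv.
by rewrite -deriveEjacobian; [exact/is_derive_line/gd|exact: gd].
Qed.

Lemma hessian_lipschitz x y u v : N x -> N y ->
  `|dotv (u *m hess x) v - dotv (u *m hess y) v| <=
  L_H * enorm (x - y) * enorm u * enorm v.
Proof.
case: fN => _ _ _ hL Nx Ny; rewrite -dotvBl -mulmxBr.
apply: le_trans (normr_dotv_mulmx_le _ _ _) _.
by rewrite !ler_wpM2r ?enorm_ge0 // hL.
Qed.

Lemma gradient_taylor x d u a : 0 <= a ->
  (forall t, 0 <= t <= a -> N (x + t *: d)) ->
  `|dotv (grad (x + a *: d)) u - dotv (grad x) u - a * dotv (d *m hess x) u|
  <= L_H / 2 * a ^+ 2 * enorm d ^+ 2 * enorm u.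
Proof.
move=> a0 Nxd; have Nx : N x.
  by have := Nxd 0; rewrite lexx a0 scale0r addr0; apply.
pose K := L_H * enorm d ^+ 2 * enorm u.
have := @normr_increment_le R
  (fun t => dotv (grad (x + t *: d)) u - dotv (d *m hess x) u / 1 * t ^+ 1)
  (fun t => dotv (d *m hess (x + t *: d)) u - dotv (d *m hess x) u * t ^+ 0)
  (fun t => K / 2 * t ^+ 2) (fun t => K * t ^+ 1) a a0.
rewrite scale0r addr0 !expr0n /= !mulr0 !subr0 => H.
rewrite [leRHS](_ : _ = K / 2 * a ^+ 2); last by rewrite /K; ring.
rewrite [X in `|X|](_ : _ = dotv (grad (x + a *: d)) u -
  dotv (d *m hess x) u / 1 * a ^+ 1 - dotv (grad x) u); last by field.
apply: H => t ta.
- by apply: is_deriveB; [exact/is_derive_gradient_line/Nxd|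
     exact: (is_derive_monomial _ 0)].
- exact: is_derive_monomial.
- rewrite expr0 mulr1 expr1.
  apply: le_trans (hessian_lipschitz _ _ _ _ (Nxd _ ta) Nx) _.
  rewrite addrAC subrr add0r enormZ ger0_norm; last by case/andP: ta.
  by rewrite le_eqVlt; apply/orP; left; apply/eqP; rewrite /K; ring.
Qed.

Lemma function_taylor x d a : 0 <= a ->
  (forall t, 0 <= t <= a -> N (x + t *: d)) ->
  `|f (x + a *: d) - f x - a * dotv (grad x) d
    - a ^+ 2 / 2 * dotv (d *m hess x) d| <= L_H / 6 * a ^+ 3 * enorm d ^+ 3.
Proof.
move=> a0 Nxd.
pose K := L_H / 2 * enorm d ^+ 3.
pose g := dotv (grad x) d; pose h := dotv (d *m hess x) d.
have := @normr_increment_le R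
  (fun t => f (x + t *: d) - g / 1 * t ^+ 1 - h / 2 * t ^+ 2)
  (fun t => dotv (grad (x + t *: d)) d - g * t ^+ 0 - h * t ^+ 1)
  (fun t => K / 3 * t ^+ 3) (fun t => K * t ^+ 2) a a0.
rewrite scale0r addr0 !expr0n /= !mulr0 !subr0 => H.
rewrite [leRHS](_ : _ = K / 3 * a ^+ 3); last by rewrite /K; field.
rewrite [X in `|X|](_ : _ = f (x + a *: d) -
  g / 1 * a ^+ 1 - h / 2 * a ^+ 2 - f x); last by rewrite /g /h; field.
apply: H => t ta.
- apply: is_deriveB; last exact: is_derive_monomial.
  by apply: is_deriveB; [exact/is_derive_f_line/Nxd|exact: (is_derive_monomial _ 0)].
- exact: is_derive_monomial.
- have [t0 tle] := andP ta.
  have := @gradient_taylor x d d t t0; rewrite -/g -/h expr0 mulr1 expr1.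
  rewrite (mulrC t) (_ : _ * enorm d = K * t ^+ 2); last by rewrite /K; ring.
  by apply => s /andP[s0 st]; apply: Nxd; rewrite s0 (le_trans st).
Qed.

(** Twice differentiating is symmetric because a function has a single value
    at each vertex of the triangle x, x + s u, x + s v: expand f at x towards
    the two other vertices, and at x + s u towards x + s v. The terms of order
    s and the symmetric terms of order s^2 cancel, and half of the antisymmetric
    part of the Hessian remains, up to O(s^3). *)
Lemma hessian_sym x u v : open N -> N x ->
  dotv (u *m hess x) v = dotv (v *m hess x) u.
Proof.
move=> oN Nx; have [w wE] : exists w, w = v - u by exists (v - u).
pose C := L_H / 6 * enorm u ^+ 3 + L_H / 6 * enorm v ^+ 3
  + L_H / 6 * enorm w ^+ 3 + L_H / 2 * enorm u ^+ 2 * enorm w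
  + L_H / 2 * enorm u * enorm w ^+ 2.
have /nbhs_ballP [r /= r0 Nball] := open_nbhs_nbhs (conj oN Nx).
pose M := `|u| + `|v|.
have M0 : 0 < M + 1 by rewrite ltr_wpDl ?addr_ge0.
have inN (a b : R) : 0 <= a -> 0 <= b -> a + b <= r / (M + 1) ->
    N (x + (a *: u + b *: v)).
  move=> a0 b0; rewrite ler_pdivlMr // => ab; apply: Nball.
  rewrite -ball_normE /= opprD addrA subrr add0r normrN.
  apply: le_lt_trans (ler_normD _ _) _; rewrite !normrZ !ger0_norm //.
  have abge0 := addr_ge0 a0 b0.
  have := mulr_ge0 a0 (normr_ge0 v); have := mulr_ge0 b0 (normr_ge0 u).
  rewrite mulrDr mulr1 /M mulrDr !mulrDl in ab.
  have [ab0|ab0] := eqVneq (a + b) 0; first by nra.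
  have : 0 < a + b by rewrite lt0r ab0.
  lra.
have key s : 0 < s -> s <= r / (M + 1) ->
    s ^+ 2 * `|dotv (u *m hess x) v - dotv (v *m hess x) u| <=
    s ^+ 3 * (2 * C).
  move=> s0 sr; have s0' := ltW s0; set y := x + s *: u.
  have Nu t : 0 <= t <= s -> N (x + t *: u).
    move=> /andP[t0 ts]; have := inN t 0 t0 (lexx _).
    by rewrite scale0r !addr0; apply; rewrite (le_trans ts).
  have Nv t : 0 <= t <= s -> N (x + t *: v).
    move=> /andP[t0 ts]; have := inN 0 t (lexx _) t0.
    by rewrite scale0r !add0r; apply; rewrite (le_trans ts).
  have Nw t : 0 <= t <= s -> N (y + t *: w).
    move=> /andP[t0 ts].
    have -> : y + t *: w = x + ((s - t) *: u + t *: v).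
      rewrite /y wE scalerBr scalerBl -addrA; congr (_ + _).
      by rewrite addrCA addrC.
    by apply: inN; rewrite ?subr_ge0 ?subrK.
  have ywE : y + s *: w = x + s *: v.
    by rewrite /y wE scalerBr -addrA; congr (_ + _); rewrite addrC subrK.
  have Ny : N y by apply: Nu; rewrite s0' lexx.
  have := function_taylor x u s s0' Nu.
  have := function_taylor x v s s0' Nv.
  have := function_taylor y w s s0' Nw; rewrite ywE.
  have := gradient_taylor x u w s s0' Nu; rewrite -/y.
  have := hessian_lipschitz y x w w Ny Nx.
  have -> : enorm (y - x) = s * enorm u.
    by rewrite /y addrAC subrr add0r enormZ gtr0_norm.
  move: (grad x) (grad y) (hess x) (hess y) => g G H H'.
  have gw : dotv (g) w = dotv (g) v - dotv (g) u.
    by rewrite wE dotvBr.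
  have uw : dotv (u *m H) w =
      dotv (u *m H) v - dotv (u *m H) u by rewrite wE dotvBr.
  have ww : dotv (w *m H) w = dotv (v *m H) v -
      dotv (v *m H) u - dotv (u *m H) v + dotv (u *m H) u.
    by rewrite wE mulmxBl dotvBl !dotvBr opprB addrA addrAC.
  rewrite gw uw ww.
  move=> T5 T4 T3 T2 T1.
  have s2 : 0 < s ^+ 2 by rewrite exprn_gt0.
  rewrite -{1}(gtr0_norm s2) -normrM ler_norml.
  move: T5; rewrite -(ler_pM2l s2) -{1}(gtr0_norm s2) -normrM ler_norml.
  move: T4; rewrite -(ler_pM2l s0) -{1}(gtr0_norm s0) -normrM ler_norml.
  move: T1 T2 T3; rewrite !ler_norml /C.
  by move=> /andP[? ?] /andP[? ?] /andP[? ?] /andP[? ?] /andP[? ?]; lra.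
apply/eqP; rewrite -subr_eq0 -normr_eq0; apply/eqP.
set D := `|_| in key *.
have D0 : 0 <= D := normr_ge0 _.
apply/eqP; rewrite eq_le D0 andbT leNgt; apply/negP => Dgt0.
(* a step so small that the bound 2 C s falls below D *)
pose s := Num.min (r / (M + 1)) (D / (2 * `|C| + 1)).
have C0 : 0 < 2 * `|C| + 1 by rewrite ltr_wpDl ?mulr_ge0.
have s0 : 0 < s by rewrite lt_min !divr_gt0.
have sD : s * (2 * `|C| + 1) <= D.
  by rewrite -ler_pdivlMr // /s ge_min lexx orbT.
have : s ^+ 2 * D <= s ^+ 2 * (s * (2 * C)).
  by rewrite mulrA -exprSr; apply: key => //; rewrite /s ge_min lexx.
have s2 : 0 < s ^+ 2 by rewrite exprn_gt0.
rewrite ler_pM2l // => Ds; have := ler_wpM2l (ltW s0) (ler_norm C).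
move: Ds sD s0; clearbody s; lra.
Qed.

End Taylor.

(** * The smallest eigenvalue of a symmetric matrix *)

Section SmallestEigenvalue.
Context {R : realType} {n : nat}.
Implicit Types (u v : 'rV[R]_n) (A : 'M[R]_n).

Lemma continuous_quadratic_form A : continuous (fun v => dotv (v *m A) v).
Proof.
have -> : (fun v => dotv (v *m A) v) =
          (fun v => \sum_i (\sum_k v 0 k * A k i) * v 0 i).
  by apply/funext => v; rewrite dotvE; apply: eq_bigr => i _; rewrite mxE.
apply: continuous_big => [|i _ v]; first exact: add_continuous.
apply: (@continuousM _ _ (fun v : 'rV[R]_n => \sum_k v 0 k * A k i)
                     (fun v : 'rV[R]_n => v 0 i)); last exact: coord_continuous.
move: v; apply: continuous_big => [|k _ v]; first exact: add_continuous.
apply: (@continuousM _ _ (fun v : 'rV[R]_n => v 0 k) (fun=> A k i)).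
  exact: coord_continuous.
exact: cst_continuous.
Qed.

Lemma compact_sphere : compact [set v : 'rV[R]_n | dotv v v = 1].
Proof.
apply: bounded_closed_compact.
  exists 1; split; first exact: num_real.
  move=> M M1 v /= v1; apply: le_trans (ltW M1).
  rewrite [leLHS]/Num.Def.normr /= mx_normrE; apply: bigmax_le => // -[i j] _.
  rewrite /= ord1 -(@ler_pXn2r _ 2) ?nnegrE // expr1n real_normK ?num_real //.
  rewrite -v1 dotvE (bigD1 j) //= expr2 lerDl sumr_ge0 // => k _.
  by rewrite -expr2 sqr_ge0.
apply: (@preimage_closed _ _ (fun v : 'rV[R]_n => dotv v v) [set 1]).
  move=> v _; have := continuous_quadratic_form 1%:M v.
  rewrite (_ : (fun v => _) = fun v => dotv v v) //.
  by apply/funext => w; rewrite mulmx1.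
exact: closed_eq.
Qed.

(** A positive semidefinite form vanishes at v only if v is in the kernel:
    otherwise it would become negative on moving from v slightly against v A. *)
Lemma psd_form_eq0 A v :
  (forall u w, dotv (u *m A) w = dotv (w *m A) u) ->
  (forall u, 0 <= dotv (u *m A) u) -> dotv (v *m A) v = 0 -> v *m A = 0.
Proof.
move=> symA psdA vAv; apply/eqP; rewrite -dotvv_eq0.
set w := v *m A; set s := dotv w w; pose K := dotv (w *m A) w.
have s0 : 0 <= s by exact: dotvv_ge0.
have K0 : 0 <= K by exact: psdA.
have quad t : 0 <= t ^+ 2 * K - 2 * t * s.
  have := psdA (v - t *: w).
  rewrite mulmxBl -scalemxAl !(dotvBl, dotvBr) !dotvZl !dotvZr vAv.
  rewrite (symA w v) -/w -/s -/K; lra.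
rewrite eq_le s0 andbT leNgt; apply/negP => sgt0.
have K1 : 0 < K + 1 by lra.
have := quad (s / (K + 1)).
rewrite (_ : _ - _ = (s / (K + 1)) ^+ 2 * (- K - 2)); last by field; lra.
by rewrite pmulr_rge0 ?exprn_gt0 ?divr_gt0 //; lra.
Qed.

(** The minimum of the Rayleigh quotient over the unit sphere is attained at an
    eigenvector, and it is below every eigenvalue. *)
Lemma lambda_min_spec A : (0 < n)%N ->
  (forall u v, dotv (u *m A) v = dotv (v *m A) u) ->
  (exists2 v, enorm v = 1 & v *m A = lambda_min A *: v) /\
  (forall v, lambda_min A * enorm v ^+ 2 <= dotv (v *m A) v).
Proof.
move=> n0 symA; pose S := [set v : 'rV[R]_n | dotv v v = 1].
have S0 : S !=set0.
  exists (delta_mx 0 (Ordinal n0)); rewrite /S /= dotvE (bigD1 (Ordinal n0)) //=.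
  rewrite big1 ?addr0 ?mxE ?eqxx ?mulr1 // => i ni.
  by rewrite !mxE eqxx (negPf ni) mulr0.
have [c + cmin] := EVT_min_rV S0 compact_sphere
  (continuous_subspaceT (continuous_quadratic_form A)).
rewrite inE /S /= => c1; set mu := dotv (c *m A) c in cmin.
have rayleigh v : mu * dotv v v <= dotv (v *m A) v.
  have [->|v0] := eqVneq v 0; first by rewrite mul0mx !dotv0l mulr0.
  have vv0 : 0 < dotv v v by rewrite lt0r dotvv_eq0 v0 dotvv_ge0.
  have e0 : enorm v != 0 by rewrite enorm_eq0.
  have := cmin ((enorm v)^-1 *: v); rewrite inE /S /=.
  rewrite -scalemxAl !dotvZl !dotvZr !mulrA -!expr2 exprVn sqr_enorm.
  rewrite mulVf ?gt_eqF // => /(_ erefl).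
  by rewrite mulrC ler_pdivlMr.
have cA : c *m A = mu *: c.
  apply/eqP; rewrite -subr_eq0 -mul_mx_scalar -mulmxBr; apply/eqP.
  apply: psd_form_eq0 => [u w|u|];
    rewrite !mulmxBr !mul_mx_scalar !dotvBl !dotvZl.
  - by rewrite symA (dotvC u w).
  - by rewrite subr_ge0.
  - by rewrite c1 mulr1 subrr.
have muE : lambda_min A = mu.
  have Emu : [set a | eigenvalue A a] mu.
    apply/eigenvalueP; exists c => //; rewrite -dotvv_eq0 c1; exact: oner_neq0.
  have lbmu : lbound [set a | eigenvalue A a] mu.
    move=> a /= /eigenvalueP [v vA v0].
    have := rayleigh v; rewrite vA dotvZl ler_pM2r //.
    by rewrite lt0r dotvv_eq0 v0 dotvv_ge0.
  apply/eqP; rewrite eq_le; apply/andP; split.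
    by apply: ge_inf => //; exists mu.
  by apply: lb_le_inf => //; exists mu.
rewrite muE; split; last by move=> v; rewrite sqr_enorm.
by exists c => //; rewrite /enorm c1 sqrtr1.
Qed.

Lemma definite_solvable A b (e : R) : 0 < e ->
  (forall v, e * enorm v ^+ 2 <= dotv (v *m A) v) ->
  exists v, v *m A = b.
Proof.
move=> e0 Apos; have Au : A \in unitmx.
  rewrite -row_free_unit; apply: inj_row_free => v vA.
  apply/eqP; rewrite -enorm_eq0 -sqrf_eq0 eq_le sqr_ge0 andbT.
  by rewrite -(pmulr_rle0 _ e0) -(dotv0l v) -vA.
by exists (b *m invmx A); rewrite mulmxKV.
Qed.

End SmallestEigenvalue.

(** * The constants as cubes *)

Section Constants.
Context {R : realType}.
Implicit Types a b : R.

Lemma powR_three_halves a : 0 <= a -> a `^ (3 / 2) = Num.sqrt a ^+ 3.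
Proof.
by move=> a0; rewrite mulrC powRrM powR12_sqrt // powR_mulrn // sqrtr_ge0.
Qed.

Lemma minr_cube a b : 0 <= a -> 0 <= b ->
  Num.min (a ^+ 3) (b ^+ 3) = Num.min a b ^+ 3.
Proof.
move=> a0 b0; rewrite /Num.min; case: (ltP a b) => ab.
  by rewrite ltr_pXn2r ?nnegrE // ab.
by rewrite ltNge ler_pXn2r ?nnegrE // ab.
Qed.

(** The guaranteed length of a step, in units of [length_scale]. *)
Definition step_factor (theta eta L_H : R) : R :=
  Num.min
    (Num.min (Num.min 1 (3 * theta / (L_H + eta)))
             (Num.min 1 (Num.min (theta / Num.sqrt (L_H + eta)) (5 * theta / 3))))
    (Num.min (Num.min (Num.sqrt (2 / L_H)) (3 * theta / (L_H + eta)))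
             (Num.min (1 / (1 + Num.sqrt (1 + L_H / 2)))
                      (6 * theta / (L_H + eta)))).

Definition length_scale (eps_g eps_H : R) : R :=
  Num.min (Num.min (eps_g / eps_H) (Num.sqrt eps_g)) eps_H.

Lemma length_scale_gt0 (eps_g eps_H : R) : 0 < eps_g -> 0 < eps_H ->
  0 < length_scale eps_g eps_H.
Proof. by move=> g0 H0; rewrite !lt_min divr_gt0 // sqrtr_gt0 g0. Qed.

Lemma step_factor_gt0 (theta eta L_H : R) : 0 < theta -> 0 < eta -> 0 < L_H ->
  0 < step_factor theta eta L_H.
Proof.
move=> t0 e0 L0; have S0 : 0 < L_H + eta by rewrite addr_gt0.
by rewrite !lt_min ?ltr01 !divr_gt0 ?mulr_gt0 ?sqrtr_gt0 ?divr_gt0 //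
   ltr_wpDr ?sqrtr_ge0.
Qed.

(** Each of the four constants is eta / 6 times a minimum of cubes. *)
Lemma c_minE (theta eta L_H : R) : 0 < theta -> 0 < eta -> 0 < L_H ->
  c_min theta eta L_H = eta / 6 * step_factor theta eta L_H ^+ 3.
Proof.
move=> t0 e0 L0; have S0 : 0 < L_H + eta by rewrite addr_gt0.
have e6 : 0 <= eta / 6 by rewrite divr_ge0 // ltW.
rewrite /c_min /c_e /c_g /c_n /c_r -!minr_pMr //; congr (_ * _).
rewrite !powR_three_halves ?divr_ge0 ?(ltW S0) ?(ltW L0) //.
rewrite (_ : 27 * theta ^+ 3 / (L_H + eta) ^+ 3 = (3 * theta / (L_H + eta)) ^+ 3);
  last by rewrite !exprMn exprVn; congr (_ * _ * _); ring.
rewrite (_ : theta ^+ 3 / Num.sqrt (L_H + eta) ^+ 3 =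
             (theta / Num.sqrt (L_H + eta)) ^+ 3); last by rewrite exprMn exprVn.
rewrite (_ : 125 * theta ^+ 3 / 27 = (5 * theta / 3) ^+ 3); last by field.
have w0 : 0 < 1 + Num.sqrt (1 + L_H / 2) by rewrite ltr_wpDr ?sqrtr_ge0.
rewrite /step_factor -!minr_cube ?expr1n //;
  by rewrite ?le_min ?divr_ge0 ?mulr_ge0 ?sqrtr_ge0 ?ler01 ?(ltW t0) ?(ltW S0)
    ?(ltW w0).
Qed.

(** The factor of the complexity bound that depends on the tolerances is at
    least [length_scale ^- 3]. *)
Lemma length_scale_max (eps_g eps_H : R) : 0 < eps_g -> 0 < eps_H ->
  1 <= length_scale eps_g eps_H ^+ 3 *
       Num.max (eps_g ^- 3 * eps_H ^+ 3)
               (Num.max (eps_g `^ (- (3 / 2))) (eps_H ^- 3)).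
Proof.
move=> g0 H0; rewrite powRN powR_three_halves; last exact: ltW.
have [m0 sg0] : 0 < length_scale eps_g eps_H /\ 0 < Num.sqrt eps_g.
  by rewrite length_scale_gt0 // sqrtr_gt0.
set M := Num.max _ _.
suff : length_scale eps_g eps_H ^- 3 <= M.
  by rewrite -ler_pdivrMl ?exprn_gt0 // mulr1.
rewrite /M /length_scale /Num.min.
case: ifP => _; last by rewrite !le_max lexx !orbT.
case: ifP => _; last by rewrite !le_max lexx !orbT.
by rewrite le_max exprMn invfM exprVn invrK lexx.
Qed.

End Constants.

(** * The line search *)

Section LineSearch.
Context {R : realType} {n : nat} {f : 'rV[R]_n -> R} {N : set 'rV[R]_n}.
Context {L_g L_H : R} (fN : twice_lipschitz_diff f N L_g L_H).
Context {theta eta : R}.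
Hypotheses (htheta : 0 < theta < 1) (heta : 0 < eta) (hL_H : 0 < L_H).
Implicit Types (x y d : 'rV[R]_n) (a r : R).

Local Notation grad := (gradient f).
Local Notation hess := (hessian f).

Lemma segment_line (x d : 'rV[R]_n) : segment x (x + d) `<=` N ->
  forall t, 0 <= t <= 1 -> N (x + t *: d).
Proof.
move=> sN t t01; apply: sN; exists t => //.
by rewrite addrAC subrr add0r.
Qed.

(** By the Taylor bound, f (x + a d) exceeds f x by at most the quadratic model
    plus L_H / 6 a^3 |d|^3; a rejection says that the excess is at least
    - eta / 6 a^3 |d|^3, and dividing by a leaves an inequality between the
    three orders. *)
Lemma insufficient_decrease_model x d a :
  segment x (x + d) `<=` N -> 0 < a <= 1 ->
  ~~ sufficient_decrease f eta x d a ->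
  0 <= dotv (grad x) d + a / 2 * dotv (d *m hess x) d
       + (L_H + eta) / 6 * a ^+ 2 * enorm d ^+ 3.
Proof.
move=> /segment_line sN /andP[a0 a1]; rewrite /sufficient_decrease -leNgt => fail.
have Nxd t : 0 <= t <= a -> N (x + t *: d).
  by move=> /andP[t0 ta]; apply: sN; rewrite t0 (le_trans ta).
have := function_taylor fN x d a (ltW a0) Nxd.
rewrite ler_norml => /andP[_ ub]; rewrite -(pmulr_rge0 _ a0); lra.
Qed.

(** As rejected steps are at least r long, backtracking stops: the accepted
    step is the full one or at least theta r long, one reduction below a
    rejected step. *)
Lemma line_search_length x d r : 0 < r ->
  (forall a, 0 < a <= 1 -> ~~ sufficient_decrease f eta x d a ->
     r <= a * enorm d) ->
  (exists y, step_ls f theta eta x d y) /\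
  (forall y, step_ls f theta eta x d y ->
     f y < f x - eta / 6 * enorm (y - x) ^+ 3 /\
     (y = x + d \/ theta * r <= enorm (y - x))).
Proof.
have /andP[t0 t1] := htheta; move=> r0 fail.
have tj01 j : 0 < theta ^+ j <= 1.
  by rewrite exprn_gt0 //= exprn_ile1 // ltW.
split=> [|y [j [dec mindec ->]]].
  have ex : exists j, sufficient_decrease f eta x d (theta ^+ j).
    have d1 : 0 < enorm d + 1 by rewrite ltr_wpDl ?enorm_ge0.
    have r1 : 0 < r / (enorm d + 1) by rewrite divr_gt0.
    have tn1 : `|theta| < 1 by rewrite gtr0_norm.
    have := cvg_expr tn1 => /cvgrPdist_lt /(_ _ r1) [j _ /(_ j (leqnn j))].
    rewrite /= sub0r normrN normrX gtr0_norm // ltr_pdivlMr // => lt_r.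
    exists j; apply: contraT => /(fail _ (tj01 j)).
    by have /andP[+ _] := tj01 j; lra.
  have [m decm minm] := ex_minnP ex.
  exists (x + theta ^+ m *: d), m; split=> // i im.
  by apply: contraL im => /minm; rewrite leqNgt.
have /andP[tj0 _] := tj01 j.
rewrite [x + _]addrC addrK enormZ gtr0_norm // addrC; split.
  by rewrite exprMn mulrA; exact: dec.
case: j dec mindec tj0 => [|j] dec mindec tj0; first by left; rewrite expr0 scale1r.
right; rewrite exprS -mulrA ler_pM2l //.
exact: fail (tj01 j) (mindec j (ltnSn j)).
Qed.

(** * How short a step can be, for each kind of direction *)

Context {eps_g eps_H : R}.
Hypotheses (heps_g : 0 < eps_g) (heps_H : 0 < eps_H).

Let S0 : 0 < L_H + eta. Proof. exact: addr_gt0. Qed.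

(** Along a direction whose curvature equals minus its length, the negative
    quadratic term dominates the cubic one until a = 3 / (L_H + eta). *)
Lemma negative_curvature_rejected x d a : segment x (x + d) `<=` N ->
  dotv (grad x) d <= 0 -> dotv (d *m hess x) d = - enorm d ^+ 3 ->
  eps_H < enorm d -> 0 < a <= 1 ->
  ~~ sufficient_decrease f eta x d a ->
  3 / (L_H + eta) * eps_H <= a * enorm d.
Proof.
move=> sN gd dHd led a01 /(insufficient_decrease_model _ _ _ sN a01); rewrite dHd => h.
have /andP[a0 a1] := a01; have d0 : 0 < enorm d ^+ 3 * a.
  by rewrite mulr_gt0 // exprn_gt0 // (lt_trans heps_H).
have : 0 <= (enorm d ^+ 3 * a) * ((L_H + eta) * a - 3) by lra.
rewrite pmulr_rge0 // subr_ge0 => le3.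
have le3a : 3 / (L_H + eta) <= a by rewrite ler_pdivrMr // mulrC.
by apply: ler_pM => //; [rewrite divr_ge0 // ltW|exact: ltW|exact: ltW].
Qed.

Lemma enorm_scaled_gradient x : 0 < enorm (grad x) ->
  enorm (- ((Num.sqrt (enorm (grad x)))^-1 *: grad x)) =
  Num.sqrt (enorm (grad x)).
Proof.
move=> g0; have q0 : 0 < Num.sqrt (enorm (grad x)) by rewrite sqrtr_gt0.
rewrite enormN enormZ gtr0_norm ?invr_gt0 //.
by rewrite -[enorm (grad x) in X in _ * X]sqr_sqrtr ?ltW // expr2 mulKf // gt_eqF.
Qed.

(** Rejection needs the quadratic or the cubic term of the model to use up its
    share, 5/6 or 1/6, of the first-order decrease. *)
Lemma scaled_gradient_rejected x a
    (d := - ((Num.sqrt (enorm (grad x)))^-1 *: grad x)) :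
  segment x (x + d) `<=` N ->
  dotv (grad x *m hess x) (grad x) <= eps_H * enorm (grad x) ^+ 2 ->
  eps_g < enorm (grad x) -> 0 < a <= 1 ->
  ~~ sufficient_decrease f eta x d a ->
  Num.min (Num.sqrt eps_g / Num.sqrt (L_H + eta)) (5 / 3 * (eps_g / eps_H))
    <= a * enorm d.
Proof.
set g := grad x in d *; set q := Num.sqrt (enorm g) in d *.
move=> sN gHg leg a01 /(insufficient_decrease_model _ _ _ sN a01).
have g0 : 0 < enorm g by exact: lt_trans leg.
have q0 : 0 < q by rewrite sqrtr_gt0.
have q2 : q ^+ 2 = enorm g by rewrite sqr_sqrtr // ltW.
have dE : enorm d = q by exact: enorm_scaled_gradient.
rewrite dE dotvNr dotvZr -sqr_enorm -q2.
rewrite mulNmx dotvNr dotvNl opprK -scalemxAl dotvZl dotvZr -/g => h.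
have /andP[a0 a1] := a01.
have dHd : q^-1 * (q^-1 * dotv (g *m hess x) g) <= eps_H * q ^+ 2.
  rewrite mulrA -invfM -expr2 mulrC ler_pdivrMr ?exprn_gt0 //.
  by apply: le_trans gHg _; rewrite -q2 -mulrA -expr2.
have {h} : 0 <= q ^+ 2 * (- q + a / 2 * eps_H + (L_H + eta) / 6 * a ^+ 2 * q).
  apply: le_trans h _.
  have -> : q^-1 * (q ^+ 2) ^+ 2 = q ^+ 3 by field; rewrite gt_eqF.
  have := ler_wpM2l (ltW a0) dHd; lra.
rewrite pmulr_rge0 ?exprn_gt0 // => h.
rewrite ge_min; have [quad|quad] := leP (5 / 3 * q) (a * eps_H).
  apply/orP; right; rewrite mulrA ler_pdivrMr //.
  have := ler_pM2r q0 (5 / 3 * q) (a * eps_H); rewrite quad.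
  rewrite -q2 in leg; lra.
apply/orP; left.
have cub : 1 <= (L_H + eta) * a ^+ 2.
  rewrite leNgt; apply/negP => lt1.
  have : ((L_H + eta) * a ^+ 2) * q < 1 * q by rewrite ltr_pM2r.
  lra.
rewrite ler_pdivrMr ?sqrtr_gt0 //.
have -> : a * q * Num.sqrt (L_H + eta) = q * Num.sqrt ((L_H + eta) * a ^+ 2).
  by rewrite (sqrtrM _ (ltW S0)) sqrtr_sqr gtr0_norm //; ring.
rewrite -[leLHS]mulr1; apply: ler_pM => //.
  by rewrite ler_sqrt // ltW.
by rewrite -[leLHS]sqrtr1 ler_wsqrtr.
Qed.

(** As a <= 1, the second-order term consumes at most half of the first-order
    decrease, so that a^2 |d| is at least 3 eps_H / (L_H + eta); and a |d| is
    no smaller, again as a <= 1. *)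
Lemma newton_rejected x d a : segment x (x + d) `<=` N ->
  d *m hess x = - grad x -> d != 0 ->
  eps_H * enorm d ^+ 2 <= dotv (d *m hess x) d -> 0 < a <= 1 ->
  ~~ sufficient_decrease f eta x d a ->
  3 / (L_H + eta) * eps_H <= a * enorm d.
Proof.
move=> sN dH d0 curv a01 /(insufficient_decrease_model _ _ _ sN a01).
have -> : dotv (grad x) d = - dotv (d *m hess x) d by rewrite dH dotvNl opprK.
move: curv; set h := dotv _ d => curv; have /andP[a0 a1] := a01.
have D0 : 0 < enorm d by rewrite lt0r enorm_eq0 d0 enorm_ge0.
move=> fail.
have : 0 <= enorm d ^+ 2 * ((L_H + eta) * a ^+ 2 * enorm d - 3 * eps_H).
  have : 0 <= (1 - a) * h.
    rewrite mulr_ge0 ?subr_ge0 // (le_trans _ curv) //.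
    by rewrite mulr_ge0 ?sqr_ge0 // ltW.
  lra.
rewrite pmulr_rge0 ?exprn_gt0 // => h1.
rewrite mulrAC ler_pdivrMr //.
have : 0 <= (1 - a) * (a * ((L_H + eta) * enorm d)).
  by rewrite mulr_ge0 ?subr_ge0 ?mulr_ge0 // ltW.
lra.
Qed.

(** Thanks to the shift, the terms of order one and two of the model decrease f
    by at least eps_H |d|^2 per unit of a, whatever the sign of the curvature;
    only the cubic term can make up for this. *)
Lemma regularized_newton_rejected x d a : segment x (x + d) `<=` N ->
  d *m (hess x + (2 * eps_H)%:M) = - grad x -> d != 0 ->
  - eps_H * enorm d ^+ 2 <= dotv (d *m hess x) d -> 0 < a <= 1 ->
  ~~ sufficient_decrease f eta x d a ->
  6 / (L_H + eta) * eps_H <= a * enorm d.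
Proof.
move=> sN dH d0 curv a01 /(insufficient_decrease_model _ _ _ sN a01).
have -> : dotv (grad x) d =
    - dotv (d *m hess x) d - 2 * eps_H * enorm d ^+ 2.
  rewrite -[grad x]opprK -dH dotvNl mulmxDr dotvDl mul_mx_scalar dotvZl.
  by rewrite -sqr_enorm opprD.
move: curv; set h := dotv _ d => curv; have /andP[a0 a1] := a01.
have D0 : 0 < enorm d by rewrite lt0r enorm_eq0 d0 enorm_ge0.
move=> fail.
have : 0 <= enorm d ^+ 2 * ((L_H + eta) * a ^+ 2 * enorm d - 6 * eps_H).
  have : 0 <= (1 - a / 2) * (h + eps_H * enorm d ^+ 2).
    by rewrite mulr_ge0 //; lra.
  have : 0 <= a * (eps_H * enorm d ^+ 2).
    by rewrite !mulr_ge0 ?sqr_ge0 // ltW.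
  lra.
rewrite pmulr_rge0 ?exprn_gt0 // => h1.
rewrite mulrAC ler_pdivrMr //.
have : 0 <= (1 - a) * (a * ((L_H + eta) * enorm d)).
  by rewrite mulr_ge0 ?subr_ge0 ?mulr_ge0 // ltW.
lra.
Qed.

(** Testing the Taylor estimate of the gradient against the remainder itself
    turns it into a bound on the norm of the remainder. *)
Lemma gradient_full_step x d : segment x (x + d) `<=` N ->
  enorm (grad (x + d) - grad x - d *m hess x) <= L_H / 2 * enorm d ^+ 2.
Proof.
move=> /segment_line sN; set z := _ - _.
have [z0|z0] := eqVneq z 0.
  by rewrite z0 enorm0 mulr_ge0 ?sqr_ge0 // divr_ge0 // ltW.
have zp : 0 < enorm z by rewrite lt0r enorm_eq0 z0 enorm_ge0.
rewrite -(ler_pM2r zp) -expr2 [leLHS]sqr_enorm.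
have := gradient_taylor fN x d z 1 ler01 sN.
by rewrite scale1r expr1n mulr1 mul1r -!dotvBl -/z => h; apply: le_trans (ler_norm _) h.
Qed.

(** A full Newton step cancels the linearized gradient, so that the new gradient
    is a Taylor remainder, of order |d|^2. *)
Lemma newton_full_step x d : segment x (x + d) `<=` N ->
  d *m hess x = - grad x -> eps_g < enorm (grad (x + d)) ->
  Num.sqrt (2 / L_H) * Num.sqrt eps_g <= enorm d.
Proof.
move=> sN dH; have := gradient_full_step _ _ sN; rewrite dH opprK subrK => ub lt_g.
have L2 : 0 <= 2 / L_H by rewrite divr_ge0 // ltW.
rewrite -sqrtrM // -[leRHS]ger0_norm ?enorm_ge0 // -sqrtr_sqr.
apply: ler_wsqrtr; rewrite mulrAC ler_pdivrMr //; lra.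
Qed.

(** A full regularized step leaves - 2 eps_H d of the linearized gradient, so
    that |d| is at least the positive root of a quadratic polynomial; the bound
    below merges the regimes where its linear or its quadratic term dominates. *)
Lemma regularized_newton_full_step x d : segment x (x + d) `<=` N ->
  d *m (hess x + (2 * eps_H)%:M) = - grad x -> eps_g < enorm (grad (x + d)) ->
  1 / (1 + Num.sqrt (1 + L_H / 2)) * Num.min (eps_g / eps_H) (Num.sqrt eps_g)
    <= enorm d.
Proof.
move=> sN dH lt_g; set D := enorm d.
have ub : eps_g < L_H / 2 * D ^+ 2 + 2 * eps_H * D.
  apply: lt_le_trans lt_g _.
  have -> : grad (x + d) = (grad (x + d) - grad x - d *m hess x)
                           + (- (2 * eps_H)) *: d.
    rewrite -[in - grad x]dH mulmxDr mul_mx_scalar scaleNr.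
    move: (d *m _) (_ *: d) (grad (x + d)) => p q G.
    by apply/rowP => i; rewrite !mxE; ring.
  apply: le_trans (enormD_le _ _) _; rewrite lerD ?gradient_full_step //.
  by rewrite enormZ normrN gtr0_norm // mulr_gt0.
set w := Num.sqrt _; set m := Num.min _ _.
have w2 : w ^+ 2 = 1 + L_H / 2 by rewrite sqr_sqrtr // addr_ge0 // divr_ge0 // ltW.
have w0 : 0 <= w by exact: sqrtr_ge0.
have w1 : 0 < 1 + w by lra.
have m0 : 0 <= m by rewrite le_min sqrtr_ge0 divr_ge0 // ltW.
have m2 : m ^+ 2 <= eps_g.
  rewrite -[leRHS]sqr_sqrtr; last exact: ltW.
  by rewrite ler_pXn2r ?nnegrE ?sqrtr_ge0 // /m ge_min lexx orbT.
have mH : m * eps_H <= eps_g by rewrite -ler_pdivlMr // /m ge_min lexx.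
have D0 : 0 <= D by exact: enorm_ge0.
rewrite leNgt; apply/negP => lt_D.
(* if D (1 + w) < m, then 1 + w times the quadratic and the linear term of the
   bound on eps_g is at most (w - 1) eps_g and 2 eps_g respectively *)
have {}lt_D : D * (1 + w) < m by move: lt_D; rewrite mul1r mulrC ltr_pdivlMr.
have DD : (D * (1 + w)) ^+ 2 <= m ^+ 2.
  by rewrite ler_pXn2r ?nnegrE ?mulr_ge0 // ltW.
have wge1 : 1 <= w by rewrite -[leLHS]sqrtr1 ler_wsqrtr // lerDl divr_ge0 // ltW.
have p1 : (w - 1) * (D * (1 + w)) ^+ 2 <= (w - 1) * eps_g.
  by rewrite ler_wpM2l ?subr_ge0 // (le_trans DD).
have p2 : eps_H * (D * (1 + w)) <= eps_g.
  by apply: le_trans mH; rewrite mulrC ler_pM2r // ltW.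
have : (1 + w) * eps_g < (1 + w) * (L_H / 2 * D ^+ 2 + 2 * eps_H * D).
  by rewrite ltr_pM2l.
have -> : L_H / 2 = w ^+ 2 - 1 by rewrite w2 addrC addKr.
lra.
Qed.

(** * Progress of one iteration *)

Context (n_gt0 : (0 < n)%N) (oN : open N).

Let hess_sym x : N x ->
  forall u v, dotv (u *m hess x) v = dotv (v *m hess x) u.
Proof. by move=> Nx u v; exact: hessian_sym fN x u v oN Nx. Qed.

(** A negative Rayleigh quotient of g serves as well as a negative eigenvalue:
    after scaling g to the length of the quotient, the slope, curvature and
    length are related as for an eigenvector of that length. *)
Lemma step1_direction x d : step1 f eps_g eps_H x = Some d ->
  [/\ dotv (grad x) d <= 0, dotv (d *m hess x) d = - enorm d ^+ 3 &
      eps_H < enorm d] \/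
  [/\ d = - ((Num.sqrt (enorm (grad x)))^-1 *: grad x),
      dotv (grad x *m hess x) (grad x) <= eps_H * enorm (grad x) ^+ 2 &
      eps_g < enorm (grad x)].
Proof.
rewrite /step1; set g := grad x; set r := _ / _.
have [//|g0] := eqVneq (enorm g) 0.
have gp : 0 < enorm g by rewrite lt0r g0 enorm_ge0.
have gHg : dotv (g *m hess x) g = r * enorm g ^+ 2.
  by rewrite /r divfK // expf_neq0.
case: ifP => [r_lt [<-]|_].
  left; have r0 : r < 0 by apply: lt_trans r_lt _; rewrite oppr_lt0.
  have dE : enorm ((r / enorm g) *: g) = - r.
    rewrite enormZ normrM normfV (gtr0_norm gp) divfK // ltr0_norm //.
  split; last by rewrite dE ltrNr.
    rewrite dotvZr -sqr_enorm mulr_le0_ge0 ?sqr_ge0 //.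
    by rewrite mulr_le0_ge0 ?invr_ge0 ?enorm_ge0 // ltW.
  rewrite dE -scalemxAl dotvZl dotvZr gHg; field.
  exact: g0.
case: ifP => // /andP[/andP[_ r_le] lt_g] [<-]; right; split => //.
by rewrite gHg ler_pM2r // exprn_gt0.
Qed.

(** The smallest eigenvalue has an eigenvector, which can be scaled to any length
    and sign, and the Newton systems are only solved where they are positive
    definite. *)
Lemma steps12_total x : N x -> exists o, steps12 f eps_g eps_H x o.
Proof.
move=> Nx; rewrite /steps12; case E: (step1 _ _ _ _) => [d|].
  by exists (Direction false d).
have [[c c1 cH] ray] := lambda_min_spec _ n_gt0 (hess_sym _ Nx).
set l := lambda_min (hess x) in cH ray *; set g := grad x.
pose m := Num.max (- l) 0.
have m0 : 0 <= m by rewrite le_max lexx orbT.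
have [v [vH vg vm]] : exists v, [/\ v *m hess x = l *: v, dotv v g <= 0 &
    enorm v = m].
  have [cg|/ltW cg] := leP (dotv c g) 0; [exists (m *: c)|exists (- m *: c)];
    rewrite -scalemxAl cH dotvZl enormZ c1 mulr1 ?normrN ger0_norm //.
  - by split => //; [rewrite !scalerA mulrC|rewrite mulr_ge0_le0].
  - by split => //; [rewrite !scalerA mulrC|rewrite mulNr oppr_le0 mulr_ge0].
have [term|nterm] := boolP ((enorm g <= eps_g) && (- eps_H <= l)).
  by exists Terminate, v; rewrite -/g -/l term.
have [neg|nneg] := boolP (l < - eps_H).
  by exists (Direction false v), v; rewrite -/g -/l (negPf nterm) neg.
have [pos|npos] := boolP (eps_H < l).
  have [d dH] : exists d, d *m hess x = - g.
    by apply: definite_solvable ray; exact: lt_trans pos.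
  exists (Direction true d), v.
  by rewrite -/g -/l (negPf nterm) (negPf nneg) pos; split=> //; exists d.
have [d dH] : exists d, d *m (hess x + (2 * eps_H)%:M) = - g.
  apply: (@definite_solvable _ _ _ _ eps_H) => // u.
  rewrite mulmxDr mul_mx_scalar dotvDl dotvZl -sqr_enorm.
  have := ray u; have : 0 <= (l + eps_H) * enorm u ^+ 2.
    by rewrite mulr_ge0 ?sqr_ge0 //; rewrite -leNgt in nneg; lra.
  lra.
exists (Direction true d), v.
by rewrite -/g -/l (negPf nterm) (negPf nneg) (negPf npos); split=> //; exists d.
Qed.

Lemma steps12_terminate x : steps12 f eps_g eps_H x Terminate ->
  enorm (grad x) <= eps_g /\ - eps_H <= lambda_min (hess x).
Proof.
rewrite /steps12; case: (step1 _ _ _ _) => // -[v [_ _ _]].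
case: ifP => [/andP[] //|_]; case: ifP => // _.
by case: ifP => _ [].
Qed.

Lemma step_factor_decrease x y :
  step_factor theta eta L_H * length_scale eps_g eps_H <= enorm (y - x) ->
  f y < f x - eta / 6 * enorm (y - x) ^+ 3 ->
  f y <= f x - c_min theta eta L_H * length_scale eps_g eps_H ^+ 3.
Proof.
move=> le_len /ltW /le_trans; apply.
have /andP[t0 _] := htheta.
rewrite c_minE // lerD2l lerN2 -mulrA ler_pM2l ?divr_gt0 // -exprMn.
have k0 : 0 <= step_factor theta eta L_H * length_scale eps_g eps_H.
  by rewrite mulr_ge0 // ltW ?step_factor_gt0 ?length_scale_gt0.
by rewrite ler_pXn2r ?nnegrE ?enorm_ge0.
Qed.

(** The decrease is eta / 6 times the cube of a step length that is at least
    step_factor * length_scale. Only a full Newton or regularized Newton step can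
    be shorter, and then it reaches a small gradient. *)
Lemma iteration_progress x b d : N x -> segment x (x + d) `<=` N ->
  steps12 f eps_g eps_H x (Direction b d) ->
  [/\ b -> - eps_H <= lambda_min (hess x),
      exists y, step_ls f theta eta x d y &
      forall y, step_ls f theta eta x d y ->
        b /\ enorm (grad y) <= eps_g \/
        f y <= f x - c_min theta eta L_H * length_scale eps_g eps_H ^+ 3].
Proof.
move=> Nx sN st.
pose k := step_factor theta eta L_H; pose m := length_scale eps_g eps_H.
have /andP[t0 t1] := htheta.
have m0 : 0 < m by exact: length_scale_gt0.
have k0 : 0 < k by exact: step_factor_gt0.
have km A B : k <= A -> m <= B -> k * m <= A * B.
  by move=> kA mB; apply: ler_pM => //; exact: ltW.
have mH : m <= eps_H by rewrite /m /length_scale ge_min lexx orbT.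
have mg : m <= Num.sqrt eps_g by rewrite /m /length_scale !ge_min lexx !orbT.
(* it is enough to bound the full step and the rejected steps *)
suff [r [r0 hr kmr full lam]] : exists r, [/\ 0 < r,
    forall a, 0 < a <= 1 -> ~~ sufficient_decrease f eta x d a ->
      r <= a * enorm d,
    k * m <= theta * r,
    b /\ enorm (grad (x + d)) <= eps_g \/ k * m <= enorm d &
    b -> - eps_H <= lambda_min (hess x)].
  have [ex len] := line_search_length _ _ _ r0 hr; split => // y /len [dec].
  case=> [yE|le_len]; last first.
    by right; apply: step_factor_decrease dec; exact: le_trans kmr le_len.
  rewrite yE in dec *; case: full => [|le_len]; first by left.
  right; apply: step_factor_decrease dec.
  by rewrite [x + d]addrC addrK.
have r3 : 0 < 3 / (L_H + eta) * eps_H by rewrite mulr_gt0 ?divr_gt0.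
have km3 : k * m <= theta * (3 / (L_H + eta) * eps_H).
  rewrite mulrA mulrA [theta * 3]mulrC; apply: km => //.
  by rewrite /k /step_factor !ge_min lexx ?orbT.
have negative : [/\ dotv (grad x) d <= 0,
    dotv (d *m hess x) d = - enorm d ^+ 3 & eps_H < enorm d] ->
  exists r, [/\ 0 < r,
    forall a, 0 < a <= 1 -> ~~ sufficient_decrease f eta x d a ->
      r <= a * enorm d, k * m <= theta * r & k * m <= enorm d].
  move=> [gd dHd led]; exists (3 / (L_H + eta) * eps_H); split => //.
    by move=> a a01; exact: negative_curvature_rejected.
  apply: le_trans (ltW led); rewrite -[leRHS]mul1r; apply: km => //.
  by rewrite /k /step_factor !ge_min lexx.
move: st; rewrite /steps12; case E: (step1 _ _ _ _) => [d'|].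
  case=> bE dE; rewrite -{d'}dE in E; rewrite bE.
  have [/negative[r [r0 hr kmr kmd]]|[dE gHg leg]] := step1_direction _ _ E.
    by exists r; split => //; right.
  exists (Num.min (Num.sqrt eps_g / Num.sqrt (L_H + eta))
                  (5 / 3 * (eps_g / eps_H))); split => //.
  - by rewrite lt_min !(mulr_gt0, divr_gt0, sqrtr_gt0, invr_gt0).
  - move=> a a01; rewrite dE in sN *.
    exact: scaled_gradient_rejected.
  - rewrite [leRHS]minr_pMr ?(ltW t0) // le_min; apply/andP; split.
      rewrite [leRHS]mulrCA [leRHS]mulrC; apply: km => //.
      by rewrite /k /step_factor !ge_min lexx !orbT.
    rewrite [leRHS](_ : _ = (5 * theta / 3) * (eps_g / eps_H)); last by ring.
    apply: km.
      by rewrite /k /step_factor !ge_min lexx !orbT.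
    by rewrite /m /length_scale !ge_min lexx.
  right; rewrite dE enorm_scaled_gradient; last exact: lt_trans leg.
  rewrite -[leRHS]mul1r; apply: km.
    by rewrite /k /step_factor !ge_min lexx.
  by apply: le_trans mg _; rewrite ler_wsqrtr // ltW.
have [_ ray] := lambda_min_spec _ n_gt0 (hess_sym _ Nx).
move=> [v [vH vg vn]]; set l := lambda_min _ in vH vn ray *.
case: ifP => // nterm; case: ifP => [neg [bE dE]|/negbT].
  rewrite bE; have vE : enorm v = - l.
    by rewrite vn max_l // oppr_ge0 ltW // (lt_trans neg) ?oppr_lt0.
  have [|r [r0 hr kmr kmd]] := negative.
    rewrite dE; split; first by rewrite dotvC.
      by rewrite vH dotvZl -sqr_enorm exprS vE mulNr opprK.
    by rewrite vE ltrNr.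
  by exists r; split => //; right.
rewrite -leNgt => l_ge; have leg : eps_g < enorm (grad x).
  by rewrite ltNge; apply: contraFN nterm => ->.
have nz A : d *m A = - grad x -> d != 0.
  move=> dA; apply: contraTneq leg => d0; rewrite -leNgt.
  by move/esym/eqP: dA; rewrite d0 mul0mx oppr_eq0 => /eqP->; rewrite enorm0 ltW.
case: ifP => [pos [d' dH [bE dE]]|npos [d' dH [bE dE]]];
  rewrite -{d'}dE in dH; rewrite bE.
  exists (3 / (L_H + eta) * eps_H); split => //.
    move=> a a01; apply: newton_rejected => //; first exact: nz dH.
    by apply: le_trans (ray d); rewrite ler_wpM2r ?sqr_ge0 // ltW.
  have [le_g|lt_g] := leP (enorm (grad (x + d))) eps_g; first by left.
  right; apply: le_trans (newton_full_step _ _ sN dH lt_g).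
  by apply: km => //; rewrite /k /step_factor !ge_min lexx !orbT.
exists (6 / (L_H + eta) * eps_H); split => //.
- by rewrite mulr_gt0 ?divr_gt0.
- move=> a a01; apply: regularized_newton_rejected => //; first exact: nz dH.
  by apply: le_trans (ray d); rewrite ler_wpM2r ?sqr_ge0.
- rewrite mulrA mulrA [theta * 6]mulrC; apply: km => //.
  by rewrite /k /step_factor !ge_min lexx !orbT.
have [le_g|lt_g] := leP (enorm (grad (x + d))) eps_g; first by left.
right; apply: le_trans (regularized_newton_full_step _ _ sN dH lt_g).
apply: km; first by rewrite /k /step_factor !ge_min lexx !orbT.
by rewrite /m /length_scale ge_min lexx.
Qed.

End LineSearch.

(** * The iteration bound *)

Theorem theorem2p5 (R : realType) (n : nat) (hn : (0 < n)%N)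
    (f : 'rV[R]_n -> R) (x0 : 'rV[R]_n)
    (theta eta eps_g eps_H : R)
    (htheta : 0 < theta < 1) (heta : 0 < eta)
    (heps_g : 0 < eps_g < 1) (heps_H : 0 < eps_H < 1)
    (x : nat -> option 'rV[R]_n) (o : nat -> option (outcome R n))
    (hrun : algorithm_run f x0 theta eta eps_g eps_H x o)
    (hcompact : compact (level_set f x0))
    (N : set 'rV[R]_n) (L_g L_H : R)
    (hL_g : 0 < L_g) (hL_H : 0 < L_H)
    (hNopen : open N)
    (hNlevel : level_set f x0 `<=` N)
    (hNsegment : forall k xk b dk,
       x k = Some xk -> o k = Some (Direction b dk) ->
       segment xk (xk + dk) `<=` N)
    (hsmooth : twice_lipschitz_diff f N L_g L_H)
    (f_low U_g U_H : R) (hU_g : 0 < U_g) (hU_H : 0 < U_H)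
    (hf_low : forall y, level_set f x0 y -> f_low <= f y)
    (hgrad : forall y, level_set f x0 y -> enorm (gradient f y) <= U_g)
    (hhess : forall y, level_set f x0 y -> opnorm (hessian f y) <= U_H) :
  exists (k : nat) (xk : 'rV[R]_n),
    [/\ x k = Some xk,
        min_gradient_norm f xk (x k.+1) <= eps_g,
        - eps_H <= lambda_min (hessian f xk) &
        k%:R <= (f x0 - f_low) / c_min theta eta L_H *
          Num.max (eps_g ^- 3 * eps_H ^+ 3)
                  (Num.max (eps_g `^ (- (3 / 2))) (eps_H ^- 3))].
Proof.
have /andP[t0 t1] := htheta; have /andP[eg0 _] := heps_g.
have /andP[eH0 _] := heps_H; have [run0 run12 runls] := hrun.
pose c := c_min theta eta L_H; pose m := length_scale eps_g eps_H.
have c0 : 0 < c.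
  by rewrite /c c_minE // mulr_gt0 ?divr_gt0 // exprn_gt0 // step_factor_gt0.
have m0 : 0 < m by exact: length_scale_gt0.
have lvl0 : level_set f x0 x0 by exact: lexx.
have flow0 : 0 <= f x0 - f_low by rewrite subr_ge0 hf_low.
set M := Num.max _ _.
have mM : 1 <= m ^+ 3 * M by exact: length_scale_max.
pose good k := exists xk, [/\ x k = Some xk,
  min_gradient_norm f xk (x k.+1) <= eps_g & - eps_H <= lambda_min (hessian f xk)].
(* iteration k takes place, and f has dropped by c m^3 in each earlier one *)
pose active k := exists xk, [/\ iteration_start f eps_g x o k = Some xk,
  x k = Some xk & f xk <= f x0 - k%:R * (c * m ^+ 3)].
have start_le k xk : f xk <= f x0 - k%:R * (c * m ^+ 3) -> f xk <= f x0.
  by move/le_trans; apply; rewrite gerBl mulr_ge0 // mulr_ge0 ?exprn_ge0 // ltW.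
have active_le k : active k -> k%:R * (c * m ^+ 3) <= f x0 - f_low.
  move=> [xk [_ _ fk]]; rewrite lerBrDr -lerBrDl.
  have := hf_low _ (start_le _ _ fk); lra.
have bound k : active k -> k%:R <= (f x0 - f_low) / c * M.
  move=> /active_le; rewrite [c * _]mulrC mulrA -ler_pdivlMr // => kle.
  have M0 : 0 <= M by rewrite -(pmulr_rge0 _ (exprn_gt0 3 m0)) (le_trans _ mM).
  rewrite -[leLHS]mulr1; apply: le_trans (ler_wpM2l (ler0n R k) mM) _.
  by rewrite mulrA ler_wpM2r.
have step k : active k -> good k \/ active k.+1.
  move=> [xk [startk xkE fk]].
  have lvlk : level_set f x0 xk by exact: start_le fk.
  have Nxk : N xk by exact: hNlevel.
  have := run12 k; rewrite startk; case oE : (o k) => [ok|]; last first.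
    have [ok st] := steps12_total hsmooth (eps_g := eps_g) eH0 hn hNopen _ Nxk.
    by move/(_ ok).
  have := runls k; rewrite xkE oE; case: ok oE => [|b d] oE.
    move=> xk1 /steps12_terminate [gk lk]; left; exists xk; split => //.
    by rewrite /min_gradient_norm xk1.
  move=> ls st; have sN := hNsegment _ _ _ _ xkE oE.
  have [lamk [y yls] prog] := iteration_progress
    hsmooth htheta heta hL_H eg0 eH0 hn hNopen _ _ _ Nxk sN st.
  case xk1E : (x k.+1) ls => [z|] ls; last by case: (ls y).
  have goodk : b -> enorm (gradient f z) <= eps_g -> good k.
    move=> bT gz; exists xk; split => //; last exact: lamk.
    by rewrite xk1E /min_gradient_norm ge_min gz orbT.
  have [[bT gz]|dec] := prog z ls; first by left; apply: goodk.
  have [/andP[bT gz]|nstop] := boolP (b && (enorm (gradient f z) <= eps_g)).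
    by left; apply: goodk.
  right; exists z; split => //.
    rewrite /iteration_start xk1E oE /stops_after_ls.
    by case: b nstop {oE st prog lamk goodk} => //= /negPf ->.
  apply: le_trans dec _; rewrite -/c -/m -natr1 mulrDl mul1r; lra.
have progress k : active k \/ exists2 j, good j & active j.
  elim: k => [|k [act|?]]; last by right.
    by left; exists x0; split => //; rewrite mul0r subr0.
  by have [gk|] := step k act; [right; exists k|left].
(* f cannot pay for K iterations *)
pose K := (Num.truncn ((f x0 - f_low) / c * M)).+1.
have [act|[k [xk [xkE gk lk]] act]] := progress K.
  by have := bound _ act; rewrite leNgt truncnS_gt.
by exists k, xk; split => //; exact: bound.
Qed.
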